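(* Let $l, s, m_1, \dots, m_s, r_1, \dots, r_s, r_{s+1}$ be positive integers with $r_1 \mid r_2,\ r_2 \mid r_3,\ \dots,\ r_s \mid r_{s+1}$. Define \[ \mathcal{A} = \{ r_1 j_1 + m_1 r_2 j_2 + \cdots + m_1 m_2 \cdots m_{s-1} r_s j_s + m_1 m_2 \cdots m_s r_{s+1} j_{s+1} : 0 \le j_{s+1} \le l-1,\ 0 \le j_i \le m_i - 1 \ (i = 1, \dots, s) \} \] and \[ \mathcal{B} = (r_1\mathbb{N} \setminus m_1 r_1 \mathbb{N}) \cup (m_1 r_2 \mathbb{N} \setminus m_1 m_2 r_2 \mathbb{N}) \cup \cdots \cup (m_1 \cdots m_{s-1} r_s \mathbb{N} \setminus m_1 \cdots m_s r_s \mathbb{N}) \cup (m_1 \cdots m_s r_{s+1} \mathbb{N} \setminus m_1 \cdots m_s r_{s+1} l \mathbb{N}). \] Then $P(\mathcal{A}; n) = Q(\mathcal{B}; n)$ for all $n \in \mathbb{N}$.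
   Context: $\mathbb{N} = \{1, 2, 3, \dots\}$. For $a \in \mathbb{N}$, $a\mathbb{N} = \{an : n \in \mathbb{N}\}$, and $X \setminus Y$ is set difference. A partition of $n$ is a finite non-increasing sequence of positive integers (parts) summing to $n$; the multiplicity of a part is the number of times it occurs. For $\mathcal{A} \subseteq \mathbb{N} \cup \{0\}$, $P(\mathcal{A}; n)$ denotes the number of partitions of $n$ in which the multiplicity of every part (that occurs) belongs to $\mathcal{A}$. For $\mathcal{B} \subseteq \mathbb{N}$, $Q(\mathcal{B}; n)$ denotes the number of partitions of $n$ all of whose parts belong to $\mathcal{B}$. By convention $P(\mathcal{A}; 0) = Q(\mathcal{B}; 0) = 1$. *)

(* Defs.v *)
From HB Require Import structures.
From mathcomp Require Import all_boot.
From mathcomp Require Import boolp classical_sets.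

Set Implicit Arguments.
Unset Strict Implicit.
Unset Printing Implicit Defensive.

Local Open Scope classical_set_scope.
Local Open Scope nat_scope.

Definition is_intpart (n : nat) (p : seq nat) : bool :=
  [&& sorted geq p, all (fun k => 0 < k) p & sumn p == n].

Record intpart (n : nat) : Type :=
  IntPart { parts :> seq nat; partsP : is_intpart n parts }.

HB.instance Definition _ n := [isSub for @parts n].
HB.instance Definition _ n := [Countable of intpart n by <:].

(* A partition of n has at most n parts, each at most n, so it can be encoded
   without loss as a bounded sequence over 'I_n.+1; this is only used to show
   that intpart n is a finType. *)
Section PartitionFinite.
Variable n : nat.

Lemma intpart_size (p : intpart n) :
  size (map (@inord n) (parts p)) <= n.
Proof.
case: p => p /= /and3P[_ p_gt0 /eqP <-]; rewrite size_map.
elim: p p_gt0 => //= k p IHp /andP[k_gt0 /IHp]; rewrite -add1n; exact: leq_add.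
Qed.

Definition intpart_code (p : intpart n) : n.-bseq 'I_n.+1 :=
  Bseq (intpart_size p).

Definition intpart_decode (b : n.-bseq 'I_n.+1) : option (intpart n) :=
  insub (map val b).

Lemma intpart_codeK : pcancel intpart_code intpart_decode.
Proof.
move=> p; rewrite /intpart_decode /=.
suff -> : map val (map (@inord n) (parts p)) = val p by rewrite valK.
rewrite -map_comp -[RHS]map_id; apply/eq_in_map => k kp /=; rewrite inordK//.
case/and3P: (partsP p) => _ _ /eqP <-; rewrite ltnS sumnE.
by rewrite (big_rem k) //= leq_addr.
Qed.

HB.instance Definition _ : isFinite (intpart n) :=
  PCanIsFinite intpart_codeK.

End PartitionFinite.

(* P(A; n) *)
Definition nb_partitions_mult (A : set nat) (n : nat) : nat :=
  #|[pred p : intpart n | all (fun k => count_mem k p \in A) p]|.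

(* Q(B; n) *)
Definition nb_partitions_parts (B : set nat) (n : nat) : nat :=
  #|[pred p : intpart n | all (fun k => k \in B) p]|.

(* The set aN, where N starts at 1, so that 0 is excluded. *)
Definition multiples (a : nat) : set nat :=
  [set a * n | n in [set n | 0 < n]].

(* The families r_1, ..., r_(s+1) and m_1, ..., m_s are functions on nat whose
   values outside these index ranges are never used. *)

(* m_1 m_2 ... m_(i-1) r_i *)
Definition coef (m r : nat -> nat) (i : nat) : nat :=
  (\prod_(1 <= k < i) m k) * r i.

Definition setA (l s : nat) (m r : nat -> nat) : set nat :=
  [set x | exists j : nat -> nat,
    [/\ j s.+1 <= l - 1,
        forall i, 1 <= i <= s -> j i <= m i - 1 &
        x = \sum_(1 <= i < s.+2) coef m r i * j i]].

Definition setB (l s : nat) (m r : nat -> nat) : set nat :=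
  (\bigcup_(i in [set i | 1 <= i <= s])
     (multiples (coef m r i) `\` multiples ((\prod_(1 <= k < i.+1) m k) * r i)))
  `|` (multiples (coef m r s.+1) `\` multiples (coef m r s.+1 * l)).

(* Main.v *)
Require Import Defs.
From mathcomp Require Import all_boot all_algebra.
From mathcomp Require Import boolp classical_sets.

(* Put c_i = m_1 ... m_(i-1) r_i, mu_i = m_i for i <= s, and mu_(s+1) = l.
   Since c_i mu_i divides c_(i+1), mixed-radix expansions are unique, so
   sum_(a in A) q^a = prod_i (1 - q^(c_i mu_i)) / (1 - q^(c_i)), and
     sum_n P(A; n) q^n = prod_i prod_(k >= 1) (1 - q^(k c_i mu_i)) / (1 - q^(k c_i)).
   In the i-th factor only the 1 / (1 - q^t) with c_i | t and not c_i mu_i | t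
   survive; these sets of t are pairwise disjoint with union B, so the product
   is the generating function of Q(B; n).  Power series are replaced by
   polynomials modulo X^(n+1). *)

(** * Partitions as multiplicity functions, counted by a coefficient of a product *)

Section Counting.
Import GRing.Theory Num.Theory.
Local Open Scope ring_scope.

Lemma sumn_count_mem (n : nat) (p : seq nat) :
    all (fun x => 0 < x <= n)%N p ->
  sumn p = (\sum_(k < n) k.+1 * count_mem k.+1 p)%N.
Proof.
elim: p => [_|x p IHp /= /andP[/andP[x_gt0 le_xn] /IHp sum_p]].
  by rewrite big1 // => k _; rewrite muln0.
under [in RHS]eq_bigr => k _ do rewrite mulnDr.
rewrite big_split /= -sum_p; congr (_ + _)%N; case: x x_gt0 le_xn => // x _ lt_xn.
rewrite (bigD1 (Ordinal lt_xn)) //= eqxx muln1 big1 ?addn0 // => k.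
by rewrite -val_eqE /= eqSS eq_sym => /negPf->; rewrite muln0.
Qed.

Section Multiplicities.
Context {n : nat}.
Implicit Types (p : intpart n) (f : {ffun 'I_n -> 'I_n.+1}).

Lemma intpart_bounds p : all (fun x => 0 < x <= n)%N p.
Proof.
case/and3P: (partsP p) => _ /allP p_gt0 /eqP sum_p; apply/allP => x xp.
by rewrite p_gt0 //= -sum_p sumnE (big_rem x) //= leq_addr.
Qed.

Lemma intpart_count_mem p k : (count_mem k p <= n)%N.
Proof.
apply: leq_trans (count_size _ _) _.
by have := intpart_size p; rewrite size_map.
Qed.

(** Index k stands for the part k+1; [inord] loses nothing because no multiplicity exceeds n. *)
Definition mults p : {ffun 'I_n -> 'I_n.+1} :=
  [ffun k : 'I_n => inord (count_mem k.+1 p)].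

Lemma multsE p (k : 'I_n) : mults p k = count_mem k.+1 p :> nat.
Proof. by rewrite ffunE inordK // ltnS intpart_count_mem. Qed.

(** Sorted sequences with equal multiplicities coincide, and every part lies in 1..n, the range that
    [mults] records. *)
Lemma mults_inj : injective mults.
Proof.
move=> p q eq_pq; apply/val_inj/(@sorted_eq _ geq).
- by move=> x y z /= xy yz; apply: leq_trans xy.
- by move=> x y /=; rewrite -eqn_leq eq_sym => /eqP.
- by case/and3P: (partsP p).
- by case/and3P: (partsP q).
apply/allP => x; rewrite mem_cat => x_pq /=.
have /andP[x_gt0 le_xn] : (0 < x <= n)%N.
  by case/orP: x_pq => /(allP (intpart_bounds _)).
case: x x_gt0 le_xn {x_pq} => // k _ lt_kn.
by rewrite -!(multsE _ (Ordinal lt_kn)) eq_pq.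
Qed.

(** The partition is rebuilt by repeating each part k+1 exactly f k times and sorting; the weight
    condition makes it sum to n. *)
Lemma mults_onto f :
  (\sum_(k < n) k.+1 * f k)%N = n -> exists p, mults p = f.
Proof.
move=> sum_f; pose s := flatten [seq nseq (f k) k.+1 | k : 'I_n].
have count_s k : count_mem k.+1 (sort geq s) =
    (\sum_(j < n) (j == k :> nat) * f j)%N.
  rewrite (permP (permEl (perm_sort _ _))) count_flatten -map_comp sumnE big_map.
  by rewrite big_enum /=; apply: eq_bigr => j _; rewrite count_nseq.
have bounds : all (fun x => 0 < x <= n)%N (sort geq s).
  rewrite (perm_all _ (permEl (perm_sort _ _))).
  by apply/allP => x /flatten_mapP[k _ /nseqP[-> _]] /=.
have count_f (k : 'I_n) : count_mem k.+1 (sort geq s) = f k.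
  rewrite count_s (bigD1 k) //= eqxx mul1n big1 ?addn0 // => j.
  by rewrite -val_eqE /= => /negPf->.
have part_s : is_intpart n (sort geq s).
  apply/and3P; split.
  - by apply: sort_sorted => x y; apply: leq_total.
  - by apply: sub_all bounds => x /andP[].
  rewrite (sumn_count_mem _ _ bounds); apply/eqP; rewrite -[RHS]sum_f.
  by apply: eq_bigr => k _; rewrite count_f.
exists (IntPart part_s); apply/ffunP => k; apply/val_inj.
by rewrite /= multsE /= count_f.
Qed.

(* The condition [a == 0] lets the parts that do not occur through. *)
Lemma card_intpart_mults (S : nat -> nat -> bool) :
  #|[pred p : intpart n | all (fun k => S k (count_mem k p)) p]|%:R =
  (\prod_(k < n) \sum_(a < n.+1 | (a == 0 :> nat) || S k.+1 a)
     'X^(k.+1 * a))`_n :> rat.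
Proof.
(* Expanding the product yields one monomial per choice f of multiplicities; it contributes 1
   exactly when the weighted sum of f is n. *)
rewrite bigA_distr_big_dep coef_sum.
under eq_bigr => f _ do rewrite prodrXr coefXn.
rewrite -natr_sum -big_mkcondr /= sum1_card -(card_imset _ mults_inj).
congr _%:R; apply/eq_card => f; rewrite [RHS]unfold_in; apply/imsetP/andP.
  case=> p; rewrite inE => /allP Sp ->; split.
    apply/familyP => k; rewrite unfold_in multsE -leqn0 leqNgt -has_count has_pred1.
    by case: (boolP (k.+1 \in (p : seq nat))) => //= /Sp.
  under eq_bigr => k _ do rewrite multsE.
  rewrite -sumn_count_mem ?intpart_bounds // eq_sym.
  by case/and3P: (partsP p).
case=> /familyP Sf /eqP sum_f; have [p def_f] := mults_onto f (esym sum_f).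
exists p; rewrite // inE; apply/allP => x xp.
have /andP[x_gt0 le_xn] := allP (intpart_bounds p) x xp.
case: x x_gt0 le_xn xp => // k _ lt_kn kp.
have := Sf (Ordinal lt_kn); rewrite unfold_in -def_f multsE /=.
by rewrite -leqn0 leqNgt -has_count has_pred1 kp.
Qed.

End Multiplicities.
End Counting.

Local Set Implicit Arguments.
Local Unset Strict Implicit.

(** * Congruence of polynomials modulo X^(n+1) *)

Section Truncation.
Import GRing.Theory.
Local Open Scope ring_scope.
Context {F : fieldType}.
Variable n : nat.
Implicit Types (p q : {poly F}).

Definition eqX p q := 'X^(n.+1) %| p - q.

Lemma eqXX p : eqX p p.
Proof. by rewrite /eqX subrr dvdp0. Qed.

Lemma eqX_sym p q : eqX p q = eqX q p.
Proof. by rewrite /eqX -dvdpNr opprB. Qed.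

Lemma eqX_trans q p r : eqX p q -> eqX q r -> eqX p r.
Proof. by rewrite /eqX => pq qr; rewrite -(subrKA q p) dvdp_add. Qed.

Lemma eqXM p p' q q' : eqX p p' -> eqX q q' -> eqX (p * q) (p' * q').
Proof.
rewrite /eqX => pp' qq'; rewrite -(subrKA (p' * q)) -mulrBl -mulrBr.
by apply: dvdp_add; [apply: dvdp_mulr | apply: dvdp_mull].
Qed.

Lemma eqX_prod (I : Type) (r : seq I) (P : pred I) (f g : I -> {poly F}) :
    (forall i, P i -> eqX (f i) (g i)) ->
  eqX (\prod_(i <- r | P i) f i) (\prod_(i <- r | P i) g i).
Proof.
move=> fg; apply: (big_ind2 (fun p q => is_true (eqX p q))) => //.
  exact: eqXX.
by move=> *; apply: eqXM.
Qed.

(** A nonzero constant term makes u coprime to X^(n+1), hence invertible modulo it. *)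
Lemma eqX_mulI (u : {poly F}) p q : u`_0 != 0 -> eqX (u * p) (u * q) -> eqX p q.
Proof.
move=> u0; rewrite /eqX -mulrBr Gauss_dvdpr // coprimep_expl //.
by rewrite coprimep_sym coprimepX rootE horner_coef0.
Qed.

Lemma eqX_coef p q i : (i <= n)%N -> eqX p q -> p`_i = q`_i.
Proof.
move=> le_in /dvdpP[d /eqP]; rewrite subr_eq => /eqP->.
by rewrite coefD coefMXn ltnS le_in add0r.
Qed.

Lemma eqX_subXn i : (n < i)%N -> eqX (1 - 'X^i) 1.
Proof. by move=> lt_ni; rewrite /eqX -dvdpNr opprB subKr dvdp_exp2l. Qed.

(* Only the terms [a <= n] of [p \Po 'X^k] have degree at most [n]. *)
Lemma eqX_comp_Xn p k : (0 < k)%N ->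
  eqX (\sum_(a < n.+1) p`_a *: 'X^(k * a)) (p \Po 'X^k).
Proof.
move=> k_gt0; rewrite -[p in p \Po _](poly_take_drop n.+1) comp_polyD comp_polyM.
rewrite comp_Xn_poly eqX_sym /eqX.
suff -> : take_poly n.+1 p \Po 'X^k = \sum_(a < n.+1) p`_a *: 'X^(k * a).
  by rewrite addrAC subrr add0r dvdp_mull // -exprM dvdp_exp2l // leq_pmull.
rewrite /take_poly poly_def linear_sum /=; apply: eq_bigr => a _.
by rewrite linearZ /= comp_Xn_poly -exprM.
Qed.

Lemma coef0_subXn i : (0 < i)%N -> (1 - 'X^i : {poly F})`_0 = 1.
Proof. by case: i => // i _; rewrite coefB coef1 coefXn subr0. Qed.

(** Factors with exponent above n are congruent to 1; the other exponents are exactly the multiples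
    of d in 1..n. *)
Lemma eqX_prod_multiples d : (0 < d)%N ->
  eqX (\prod_(k < n) (1 - 'X^(k.+1 * d)))
      (\prod_(t < n | (d %| t.+1)%N) (1 - 'X^(t.+1))).
Proof.
move=> d_gt0.
rewrite (bigID (fun k : 'I_n => k.+1 * d <= n)%N) /= -[X in eqX _ X]mulr1.
apply: eqXM; last first.
  have /(eqX_prod (index_enum 'I_n)) :
      forall k : 'I_n, ~~ (k.+1 * d <= n)%N -> eqX (1 - 'X^(k.+1 * d)) 1.
    by move=> k; rewrite -ltnNge; apply: eqX_subXn.
  by rewrite [X in eqX _ X]big1.
set lhs := (X in eqX X _).
suff -> : lhs = \prod_(t < n | (d %| t.+1)%N) (1 - 'X^(t.+1)).
  exact: eqXX.
rewrite /lhs -(big_mkord (fun k => k.+1 * d <= n)%N (fun k => 1 - 'X^(k.+1 * d))).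
rewrite -(big_mkord (fun t => d %| t.+1)%N (fun t => 1 - 'X^(t.+1))).
(* With indices shifted to 1..n, both products run over duplicate-free lists of exponents, which
   need only have the same members. *)
rewrite -(big_add1 _ _ _ n.+1 (fun k => k * d <= n)%N (fun k => 1 - 'X^(k * d))).
rewrite -(big_add1 _ _ _ n.+1 (fun t => d %| t)%N (fun t => 1 - 'X^t)).
rewrite -big_filter -[RHS]big_filter -(big_map (muln^~ d) predT (fun t => 1 - 'X^t)).
apply/perm_big/uniq_perm.
- rewrite map_inj_uniq ?filter_uniq ?iota_uniq // => x y /eqP.
  by rewrite eqn_pmul2r // => /eqP.
- by rewrite filter_uniq ?iota_uniq.
move=> t; rewrite mem_filter mem_index_iota; apply/mapP/idP => [[k]|].
  rewrite mem_filter mem_index_iota ltnS => /andP[le_kd /andP[k_gt0 _]] ->.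
  by rewrite dvdn_mull // muln_gt0 k_gt0 d_gt0.
case/andP => /dvdnP[k ->]; rewrite muln_gt0 d_gt0 andbT ltnS => /andP[k_gt0 le_kd].
exists k => //; rewrite mem_filter le_kd mem_index_iota k_gt0 ltnS.
by apply: leq_trans le_kd; rewrite leq_pmulr.
Qed.

End Truncation.

Local Unset Implicit Arguments.
Local Set Strict Implicit.

(** * Mixed-radix expansions and their generating polynomial *)

Section MixedRadix.
Variables c mu : nat -> nat.

Definition radix_rep (s a : nat) : Prop :=
  exists2 j : nat -> nat,
    forall i, i < s -> j i < mu i & a = \sum_(i < s) c i * j i.

Lemma radix_rep0 s : (forall i, i < s -> 0 < mu i) -> radix_rep s 0.
Proof.
by exists (fun=> 0) => //; rewrite big1 // => i _; rewrite muln0.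
Qed.

(** By induction the lower digits contribute less than c_s, so adding the top digit keeps the total
    below c_s mu_s, which is at most c_(s+1). *)
Lemma radix_rep_lt s a :
    (forall i, i <= s -> 0 < c i) ->
    (forall i, i < s -> c i * mu i %| c i.+1) ->
  radix_rep s a -> a < c s.
Proof.
elim: s a => [|s IHs] a c_gt0 c_dvd [j lt_j ->]; first by rewrite big_ord0 c_gt0.
rewrite big_ord_recr /=; apply: leq_trans (dvdn_leq (c_gt0 _ _) (c_dvd s _)) => //.
apply: leq_trans (leq_mul (leqnn (c s)) (lt_j s (leqnn _))).
rewrite mulnS ltn_add2r; apply: IHs => [i le_is|i lt_is|].
- exact/c_gt0/leqW.
- exact/c_dvd/ltnW.
by exists j => // i lt_is; apply/lt_j/ltnW.
Qed.

(** The lower digits contribute less than c_s, so the top digit and the rest are forced to be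
    quotient and remainder by c_s. This is where uniqueness of expansions enters. *)
Lemma radix_repS s a :
    (forall i, i <= s -> 0 < c i) ->
    (forall i, i < s -> c i * mu i %| c i.+1) ->
  radix_rep s.+1 a <-> a %/ c s < mu s /\ radix_rep s (a %% c s).
Proof.
move=> c_gt0 c_dvd; split=> [[j lt_j ->]|[lt_q [j lt_j def_r]]].
  have rep_j : radix_rep s (\sum_(i < s) c i * j i).
    by exists j => // i lt_is; apply/lt_j/ltnW.
  have lt_c := radix_rep_lt _ _ c_gt0 c_dvd rep_j.
  rewrite big_ord_recr /= addnC [c s * _]mulnC modnMDl modn_small //.
  by rewrite divnMDl ?c_gt0 // divn_small // addn0 lt_j.
exists (fun i => if i == s then a %/ c s else j i) => [i|].
  by rewrite ltnS leq_eqVlt; case: eqP => [->|_] //= /lt_j.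
rewrite big_ord_recr /= eqxx {1}(divn_eq a (c s)) addnC mulnC def_r.
by congr addn; apply: eq_bigr => i _; rewrite ltn_eqF.
Qed.

Import GRing.Theory.
Local Open Scope ring_scope.

Lemma coef_radix_prod (R : comNzRingType) (s a : nat) :
    (forall i, (i < s)%N -> (0 < c i)%N) ->
    (forall i, (i.+1 < s)%N -> (c i * mu i %| c i.+1)%N) ->
  (\prod_(i < s) \sum_(j < mu i) 'X^(c i * j) : {poly R})`_a =
    `[< radix_rep s a >]%:R.
Proof.
elim: s a => [|s IHs] a c_gt0 c_dvd.
  rewrite big_ord0 coef1; congr (nat_of_bool _)%:R.
  apply/idP/asboolP => [/eqP->|[j _]].
    by exists (fun=> 0%N) => //; rewrite big_ord0.
  by rewrite big_ord0 => ->.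
rewrite big_ord_recr /=; set p := (X in X * _).
have coef_p b : p`_b = `[< radix_rep s b >]%:R.
  apply: IHs => i lt_is; first exact/c_gt0/ltnW.
  exact/c_dvd/ltnW.
have p0 b : (c s <= b)%N -> p`_b = 0.
  rewrite coef_p leqNgt; case: asboolP => // rep_b /negP[].
  exact: radix_rep_lt rep_b.
have cs_gt0 : (0 < c s)%N by apply: c_gt0.
rewrite mulr_sumr coef_sum.
(* Only the quotient digit survives: a smaller j asks for a coefficient of p at an index at least
   c_s, which vanishes, and a larger j shifts p beyond a. *)
under eq_bigr => j _.
  have -> : (p * 'X^(c s * j))`_a =
      if (j == a %/ c s :> nat)%N then p`_(a %% c s) else 0.
    rewrite coefMXn mulnC; case: (ltngtP j (a %/ c s)) => [lt_jq|lt_qj|->].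
    - have le_jq : (j.+1 * c s <= a)%N by rewrite -leq_divRL.
      have le_j : (j * c s <= a)%N by rewrite (leq_trans _ le_jq) ?leq_mul.
      by rewrite ltnNge le_j p0 // leq_subRL // addnC -mulSn.
    - by rewrite -ltn_divLR ?lt_qj.
    by rewrite ltnNge leq_divM /= {1}(divn_eq a (c s)) addKn.
  over.
rewrite -big_mkcond /=.
have -> : `[< radix_rep s.+1 a >] =
    (a %/ c s < mu s)%N && `[< radix_rep s (a %% c s) >].
  apply/asboolP/andP => [/(radix_repS _ _ c_gt0 c_dvd)[? ?]|[? /asboolP ?]].
    by split=> //; apply/asboolP.
  exact/(radix_repS _ _ c_gt0 c_dvd).
case: ltnP => [lt_q|le_q]; last first.
  by rewrite big1 // => j /eqP eq_j; have := ltn_ord j; rewrite eq_j ltnNge le_q.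
by rewrite (big_pred1 (Ordinal lt_q)) // coef_p.
Qed.

End MixedRadix.

(** * Cancellation in the infinite products, modulo X^(n+1) *)

Section Euler.
Import GRing.Theory.
Local Open Scope ring_scope.

Lemma mul_geom_Xn (R : nzRingType) (k c m : nat) :
  (1 - 'X^(k * c) : {poly R}) * (\sum_(j < m) 'X^(k * (c * j))) =
  1 - 'X^(k * (c * m)).
Proof.
under eq_bigr => j _ do rewrite mulnA exprM.
by rewrite mulnA (exprM _ (k * c) m) -[RHS]opprB subrX1 -mulNr opprB.
Qed.

Lemma prod_if_unique (R : comNzRingType) (I : finType) (P : pred I) (x : R) :
    (forall i j, P i -> P j -> i = j) ->
  \prod_i (if P i then x else 1) = if [exists i, P i] then x else 1.
Proof.
move=> uniqP; case: existsP => [[i Pi]|noP].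
  rewrite -big_mkcond (big_pred1 i) // => j.
  by apply/idP/eqP => [Pj|->//]; apply: uniqP.
by rewrite big1 // => i _; case: ifP => // Pi; case: noP; exists i.
Qed.

Variables (c mu : nat -> nat) (s n : nat).
Hypothesis c_gt0 : forall i, (i < s)%N -> (0 < c i)%N.
Hypothesis mu_gt0 : forall i, (i < s)%N -> (0 < mu i)%N.
Hypothesis c_dvd : forall i, (i.+1 < s)%N -> (c i * mu i %| c i.+1)%N.

Definition in_block t (i : 'I_s) : bool := (c i %| t)%N && ~~ (c i * mu i %| t)%N.

Lemma chain_dvd i j : (i < j < s)%N -> (c i * mu i %| c j)%N.
Proof.
elim: j => // j IHj /andP[]; rewrite ltnS leq_eqVlt => /predU1P[<-|lt_ij] lt_js.
  exact: c_dvd.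
apply: dvdn_trans (c_dvd _ lt_js); apply: dvdn_mulr; apply: IHj.
by rewrite lt_ij ltnW.
Qed.

(** For i < j, c_i mu_i divides c_j, so a multiple of c_j is excluded from block i. *)
Lemma in_block_inj t i j : in_block t i -> in_block t j -> i = j.
Proof.
wlog lt_ij : i j / (i < j)%N => [wlt_ij Bi Bj|].
  by case: (ltngtP i j) => [/wlt_ij->|/wlt_ij->|/val_inj].
case/andP=> _ /negP nd_t /andP[d_t _]; case: nd_t; apply: dvdn_trans d_t.
by rewrite chain_dvd // lt_ij ltn_ord.
Qed.

Notation sumXn k P := (\sum_(a < n.+1 | (a == 0 :> nat) || P a) 'X^(k * a)).

(** With p the generating polynomial of the representable numbers, the right factor at k is
    p(X^(k+1)), and the left one keeps its terms of multiplicity at most n. *)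
Lemma prod_mults_radix :
  eqX n (\prod_(k < n) sumXn k.+1 (fun a : 'I_n.+1 => `[< radix_rep c mu s a >]))
        (\prod_(k < n) \prod_(i < s) \sum_(j < mu i) 'X^(k.+1 * (c i * j))
          : {poly rat}).
Proof.
apply: eqX_prod => k _.
pose p : {poly rat} := \prod_(i < s) \sum_(j < mu i) 'X^(c i * j).
have -> : \prod_(i < s) \sum_(j < mu i) 'X^(k.+1 * (c i * j)) = p \Po 'X^(k.+1).
  rewrite rmorph_prod; apply: eq_bigr => i _; rewrite rmorph_sum.
  by apply: eq_bigr => j _; rewrite /= comp_Xn_poly exprM.
have -> : sumXn k.+1 (fun a : 'I_n.+1 => `[< radix_rep c mu s a >]) =
    \sum_(a < n.+1) p`_a *: 'X^(k.+1 * a).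
  rewrite big_mkcond; apply: eq_bigr => a _; rewrite coef_radix_prod //.
  (* Zero is itself representable, so admitting absent parts adds no term. *)
  have -> : (a == 0 :> nat) || `[< radix_rep c mu s a >] = `[< radix_rep c mu s a >].
    by case: eqP => //= ->; apply/esym/asboolP/radix_rep0.
  by case: asboolP; rewrite ?scale1r ?scale0r.
exact: eqX_comp_Xn.
Qed.

Let B t := [exists i, in_block t i].

(** For each i, the multiples of c_i up to n split into block i and the multiples of c_i mu_i;
    disjointness of the blocks merges their products into one over B. *)
Lemma mul_prod_blocks :
  eqX n (\prod_(t < n | B t.+1) (1 - 'X^(t.+1)) *
         \prod_(i < s) \prod_(k < n) (1 - 'X^(k.+1 * (c i * mu i))))
        (\prod_(i < s) \prod_(k < n) (1 - 'X^(k.+1 * c i)) : {poly rat}).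
Proof.
have -> : \prod_(t < n | B t.+1) (1 - 'X^(t.+1)) =
  \prod_(i < s) \prod_(t < n | in_block t.+1 i) (1 - 'X^(t.+1)) :> {poly rat}.
  under [RHS]eq_bigr => i _ do rewrite big_mkcond.
  rewrite exchange_big big_mkcond /=; apply: eq_bigr => t _.
  by rewrite prod_if_unique // => i j; apply: in_block_inj.
rewrite -big_split; apply: eqX_prod => i _ /=.
have ci_gt0 : (0 < c i)%N by apply: c_gt0.
have d_gt0 : (0 < c i * mu i)%N by rewrite muln_gt0 ci_gt0 mu_gt0.
apply: eqX_trans (eqXM (eqXX n _) (eqX_prod_multiples n d_gt0)) _.
rewrite eqX_sym; apply: eqX_trans (eqX_prod_multiples n ci_gt0) _.
rewrite (bigID (fun t : 'I_n => (c i * mu i %| t.+1)%N)) mulrC /=.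
under [X in eqX _ (X * _) _]eq_bigl => t.
  rewrite andb_idl; last by apply: dvdn_trans; apply: dvdn_mulr.
  over.
exact: eqXX.
Qed.

Lemma mul_prod_sums :
  eqX n (\prod_(t < n | B t.+1) (1 - 'X^(t.+1)) *
         \prod_(t < n) sumXn t.+1 (fun=> B t.+1)) (1 : {poly rat}).
Proof.
rewrite big_mkcond -big_split /=.
apply: (@eqX_trans _ n (\prod_(t < n) 1)); last by rewrite big1 // eqXX.
apply: eqX_prod => t _; case: ifP => Bt.
  under eq_bigl => a do rewrite orbT.
  (* This fits [mul_geom_Xn] with c = 1 and m = n+1; the product is 1 minus a power of X beyond
     degree n. *)
  under eq_bigr => a _ do rewrite -[nat_of_ord a]mul1n.
  rewrite -[X in 1 - 'X^X]muln1 mul_geom_Xn mul1n; apply: eqX_subXn.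
  by rewrite leq_pmull.
under eq_bigl => a do rewrite orbF.
by rewrite (big_pred1 ord0) // mul1r muln0 expr0; apply: eqXX.
Qed.

Lemma eqX_mults_parts :
  eqX n (\prod_(k < n) sumXn k.+1 (fun a : 'I_n.+1 => `[< radix_rep c mu s a >]))
        (\prod_(t < n) sumXn t.+1 (fun=> B t.+1) : {poly rat}).
Proof.
(* Modulo X^(n+1): W T = V, L V = W and L Q = 1, hence L W T = L W Q, and the
   unit L W cancels. *)
set T := (X in eqX _ X _); set Q := (X in eqX _ _ X).
pose L : {poly rat} := \prod_(t < n | B t.+1) (1 - 'X^(t.+1)).
pose V : {poly rat} := \prod_(i < s) \prod_(k < n) (1 - 'X^(k.+1 * (c i * mu i))).
pose W : {poly rat} := \prod_(i < s) \prod_(k < n) (1 - 'X^(k.+1 * c i)).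
have WT : eqX n (W * T) V.
  apply: eqX_trans (eqXM (eqXX _ _) prod_mults_radix) _.
  (* Regrouped by k and i, each factor of W meets its geometric sum and telescopes to the matching
     factor of V. *)
  rewrite /W exchange_big -big_split /=.
  under eq_bigr => k _ do
    rewrite -big_split /= (eq_bigr _ (fun i _ => mul_geom_Xn _ _ _ _)).
  by rewrite exchange_big; apply: eqXX.
have L0 : L`_0 = 1 by rewrite coef0_prod big1 // => t _; apply: coef0_subXn.
have W0 : W`_0 = 1.
  rewrite coef0_prod big1 // => i _; rewrite coef0_prod big1 // => k _.
  by rewrite coef0_subXn // muln_gt0 c_gt0.
apply: (@eqX_mulI _ n (L * W)); first by rewrite coef0M L0 W0 mulr1 oner_eq0.
rewrite -mulrA; apply: eqX_trans (eqXM (eqXX _ _) WT) _.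
apply: eqX_trans mul_prod_blocks _; rewrite -/W mulrAC -[W in eqX _ W _]mul1r.
by apply: eqXM (eqXX _ _); rewrite eqX_sym; apply: mul_prod_sums.
Qed.

End Euler.

(** * The sets A and B in terms of digits and blocks *)

Section Blocks.
Variables (l s : nat) (m r : nat -> nat).

(* The paper's blocks 1, ..., s.+1 become blocks 0, ..., s. *)
Definition block_step (i : nat) : nat := coef m r i.+1.
Definition block_size (i : nat) : nat := if i == s then l else m i.+1.

Lemma coef_mulm i : coef m r i.+1 * m i.+1 = \prod_(1 <= k < i.+2) m k * r i.+1.
Proof. by rewrite /coef [in RHS]big_nat_recr //= mulnAC. Qed.

(** Positivity of l and of the m_i turns the bounds l - 1 and m_i - 1, with truncated subtraction,
    into strict digit bounds. *)
Lemma mem_setA a :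
    0 < l -> (forall i, 1 <= i <= s -> 0 < m i) ->
  (a \in setA l s m r) = `[< radix_rep block_step block_size s.+1 a >].
Proof.
move=> l_gt0 m_gt0; apply/idP/asboolP; rewrite inE.
  case=> j [lt_jl lt_jm ->]; exists (fun i => j i.+1) => [i|]; last first.
    by rewrite big_add1 big_mkord.
  rewrite ltnS /block_size => le_is; case: eqP => [->|/eqP neq_is].
    by rewrite -(subnK l_gt0) addn1 ltnS.
  have lt_is : i < s by rewrite ltn_neqAle neq_is.
  by rewrite -(subnK (m_gt0 i.+1 lt_is)) addn1 ltnS lt_jm.
case=> j lt_j ->; exists (fun i => j i.-1); split=> [|i i_s|].
- by have := lt_j s (leqnn _); rewrite /block_size eqxx leq_subRL.
- have := lt_j i.-1; rewrite /block_size; case: i i_s => // i /= lt_is.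
  by rewrite ltn_eqF // leq_subRL ?m_gt0 //; apply; apply: ltnW.
by rewrite big_add1 big_mkord.
Qed.

Lemma multiplesP a t : 0 < t -> multiples a t <-> a %| t.
Proof.
move=> t_gt0; split=> [[k _ <-]|/dvdnP[k def_t]]; first exact: dvdn_mulr.
exists k; last by rewrite mulnC.
by move: t_gt0; rewrite def_t muln_gt0 => /andP[].
Qed.

Lemma mem_setB t : 0 < t ->
  (t \in setB l s m r) =
    [exists i : 'I_s.+1, in_block block_step block_size s.+1 t i].
Proof.
move=> t_gt0; apply/idP/existsP; rewrite inE.
  case=> [[i /andP[i_gt0 le_is] []]|[]].
    case: i i_gt0 le_is => // i _ lt_is.
    rewrite -coef_mulm !multiplesP // => d_t /negP nd_t.
    exists (Ordinal (ltnW lt_is : i < s.+1)).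
    by rewrite /in_block /block_size /= ltn_eqF // d_t.
  rewrite !multiplesP // => d_t /negP nd_t; exists ord_max.
  by rewrite /in_block /block_size /= eqxx d_t.
case=> i /andP[]; rewrite /block_size; case: eqP => [-> d_t /negP nd_t|/eqP neq_is].
  by right; split; rewrite multiplesP.
move=> d_t /negP nd_t; left; exists i.+1.
  by have : i < s by rewrite ltn_neqAle neq_is -ltnS ltn_ord.
by split; rewrite -?coef_mulm multiplesP.
Qed.

End Blocks.

Theorem theorem3p1 (l s : nat) (m r : nat -> nat)
  (l_gt0 : 0 < l) (s_gt0 : 0 < s)
  (m_gt0 : forall i, 1 <= i <= s -> 0 < m i)
  (r_gt0 : forall i, 1 <= i <= s.+1 -> 0 < r i)
  (r_dvd : forall i, 1 <= i <= s -> r i %| r i.+1)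
  (n : nat) (n_gt0 : 0 < n) :
  nb_partitions_mult (setA l s m r) n = nb_partitions_parts (setB l s m r) n.
Proof.
pose c := block_step m r; pose mu := block_size l s m.
have mu_gt0 i : i < s.+1 -> 0 < mu i.
  rewrite ltnS /mu /block_size => le_is; case: eqP => // /eqP neq_is.
  by apply/m_gt0; have : i < s by rewrite ltn_neqAle neq_is.
have c_gt0 i : i < s.+1 -> 0 < c i.
  move=> le_is; rewrite muln_gt0 r_gt0 // andbT big_seq prodn_cond_gt0 // => k.
  rewrite mem_index_iota ltnS => /andP[k_gt0 le_ki].
  by rewrite m_gt0 // k_gt0 (leq_trans le_ki).
(* Both sides share the product of the m_k, which reduces the claim to the divisibility chain of the
   r_i. *)
have c_dvd i : i.+1 < s.+1 -> c i * mu i %| c i.+1.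
  rewrite ltnS /mu /block_size => lt_is; rewrite ltn_eqF // coef_mulm.
  by rewrite dvdn_mul // r_dvd.
(* Cast to [rat], both counts become coefficients at n of polynomials over a field. *)
apply/eqP; rewrite -(Num.Theory.eqr_nat rat); apply/eqP.
rewrite /nb_partitions_mult (card_intpart_mults (fun _ a => a \in setA l s m r)).
rewrite /nb_partitions_parts (card_intpart_mults (fun k _ => k \in setB l s m r)).
under eq_bigr => k _ do under eq_bigl => a do rewrite mem_setA //.
under [in RHS]eq_bigr => k _ do under eq_bigl => a do rewrite mem_setB //.
exact/(eqX_coef (leqnn n))/eqX_mults_parts.
Qed.
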